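(* Let $R$ be a commutative unital ring, let $g:\mathbb{A}\to\mathbb{B}$ be a homomorphism of (not necessarily unital) $R$-algebras, and suppose that $\mathbb{B}$ is a firm $\mathbb{B}$-module. Then there is a functor $$E_g:\ {}_{\mathbb{A}}\mathrm{Mod}\to {}_{\mathbb{B}}\mathrm{FMod}$$ from the category of left $\mathbb{A}$-modules to the category of firm left $\mathbb{B}$-modules such that $E_g(M)=\mathbb{B}\otimes_{\mathbb{A}}M$ for every left $\mathbb{A}$-module $M$, where $\mathbb{B}$ has the right $\mathbb{A}$-module structure given by $g$, and such that for every homomorphism $f:M\to N$ of left $\mathbb{A}$-modules, $E_g(f)$ is the map $b\otimes m\mapsto b\otimes f(m)$.
   Context: An $R$-algebra $\mathbb{A}$ (not assumed unital) is a unital left $R$-module with an associative $R$-bilinear multiplication; algebra homomorphisms are $R$-linear multiplicative maps. A left $\mathbb{A}$-module is an abelian group $M$ with a unital left $R$-module structure and a biadditive action $\mathbb{A}\times M\to M$ such that $a.(b.m)=(ab).m$ and $r.(a.m)=(r.a).m=a.(r.m)$; right modules are defined symmetrically. Module homomorphisms are $R$-linear maps compatible with the action of $\mathbb{A}$. For a right $\mathbb{A}$-module $M$ and a left $\mathbb{A}$-module $N$, $M\otimes_{\mathbb{A}}N$ is the quotient of the free abelian group on $M\times N$ by the subgroup generated by the elements $(m+m',n)-(m,n)-(m',n)$, $(m,n+n')-(m,n)-(m,n')$, $(m.a,n)-(m,a.n)$ and $(m.r,n)-(m,r.n)$, for $m,m'\in M$, $n,n'\in N$, $a\in\mathbb{A}$,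 $r\in R$. A left $\mathbb{A}$-module $M$ is firm if the natural map $\mathbb{A}\otimes_{\mathbb{A}}M\to M$, $a\otimes m\mapsto a.m$, is an isomorphism; ${}_{\mathbb{A}}\mathrm{FMod}$ is the full subcategory of firm modules in ${}_{\mathbb{A}}\mathrm{Mod}$. The right $\mathbb{A}$-module structure on $\mathbb{B}$ given by $g$ is $b.a=b\,g(a)$ and $b.r=r.b$. The left $\mathbb{B}$-module structure on $\mathbb{B}\otimes_{\mathbb{A}}M$ is $b'.(b\otimes m)=(b'b)\otimes m$ and $r.(b\otimes m)=(r.b)\otimes m$. *)

(* Defs.v *)
From HB Require Import structures.
From mathcomp Require Import all_boot all_algebra.
From mathcomp Require Import boolp classical_sets.
From mathcomp.multinomials Require Import freeg.

Set Implicit Arguments.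
Unset Strict Implicit.
Unset Printing Implicit Defensive.

Import GRing.Theory.
Local Open Scope ring_scope.
Local Open Scope quotient_scope.

(* Multiplication is the operation of the underlying semigroup, written
   [(x * y)%g]; no unit is required. *)
HB.mixin Record Lmodule_Semigroup_isNuAlgebra (R : comPzRingType) A
    of GRing.Lmodule R A & Semigroup A := {
  numulDl : forall x y z : A, ((x + y)%R * z)%g = (x * z)%g + (y * z)%g;
  numulDr : forall x y z : A, (x * (y + z)%R)%g = (x * y)%g + (x * z)%g;
  nuscaleAl : forall (r : R) (x y : A), r *: (x * y)%g = ((r *: x)%R * y)%g;
  nuscaleAr : forall (r : R) (x y : A), r *: (x * y)%g = (x * (r *: y)%R)%g
}.

#[short(type="nuAlgType")]
HB.structure Definition NuAlgebra (R : comPzRingType) :=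
  {A of Lmodule_Semigroup_isNuAlgebra R A & GRing.Lmodule R A & Semigroup A}.

HB.structure Definition NuAlgMorphism (R : comPzRingType) (A B : nuAlgType R) :=
  {f of @GRing.Linear R A B *:%R f & @Multiplicative A B f}.

Notation "{ 'nualg' A -> B }" := (NuAlgMorphism.type A%type B%type)
  (at level 0, A at level 98, B at level 99, format "{ 'nualg'  A  ->  B }")
  : type_scope.

HB.mixin Record Lmodule_isLeftMod (R : comPzRingType) (A : nuAlgType R) M
    of GRing.Lmodule R M := {
  act : A -> M -> M;
  actDl : forall (a b : A) (m : M), act (a + b) m = act a m + act b m;
  actDr : forall (a : A) (m n : M), act a (m + n) = act a m + act a n;
  actA : forall (a b : A) (m : M), act a (act b m) = act (a * b)%g m;
  actZl : forall (r : R) (a : A) (m : M), r *: act a m = act (r *: a) m;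
  actZr : forall (r : R) (a : A) (m : M), r *: act a m = act a (r *: m)
}.

#[short(type="leftModType")]
HB.structure Definition LeftMod (R : comPzRingType) (A : nuAlgType R) :=
  {M of Lmodule_isLeftMod R A M & GRing.Lmodule R M}.

(* R being commutative, the right R-module structure m.r is written r *: m. *)
HB.mixin Record Lmodule_isRightMod (R : comPzRingType) (A : nuAlgType R) M
    of GRing.Lmodule R M := {
  ract : M -> A -> M;
  ractDl : forall (m n : M) (a : A), ract (m + n) a = ract m a + ract n a;
  ractDr : forall (m : M) (a b : A), ract m (a + b) = ract m a + ract m b;
  ractA : forall (m : M) (a b : A), ract (ract m a) b = ract m (a * b)%g;
  ractZl : forall (r : R) (m : M) (a : A), r *: ract m a = ract (r *: m) a;
  ractZr : forall (r : R) (m : M) (a : A), r *: ract m a = ract m (r *: a)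
}.

#[short(type="rightModType")]
HB.structure Definition RightMod (R : comPzRingType) (A : nuAlgType R) :=
  {M of Lmodule_isRightMod R A M & GRing.Lmodule R M}.

HB.mixin Record isEquivariant (R : comPzRingType) (A : nuAlgType R)
    (M N : leftModType A) (f : M -> N) := {
  equivariant_act : forall (a : A) (m : M), f (act a m) = act a (f m)
}.

HB.structure Definition LeftModMorphism (R : comPzRingType) (A : nuAlgType R)
    (M N : leftModType A) :=
  {f of @isEquivariant R A M N f & @GRing.Linear R M N *:%R f}.

Notation "{ 'lmodhom' M -> N }" := (LeftModMorphism.type M%type N%type)
  (at level 0, M at level 98, N at level 99, format "{ 'lmodhom'  M  ->  N }")
  : type_scope.

Section SubgroupSpan.
Variables (V : zmodType) (X : set V).

Definition zspan : {pred V} :=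
  fun v => `[< forall S : zmodClosed V, (forall x, X x -> x \in S) -> v \in S >].

Lemma zspan_zmod_closed : zmod_closed zspan.
Proof.
split=> [|u v /asboolP uX /asboolP vX]; apply/asboolP => S XS.
  exact: rpred0.
by rewrite rpredB ?uX ?vX.
Qed.
HB.instance Definition _ := GRing.isZmodClosed.Build V zspan zspan_zmod_closed.

Lemma zspan_gen x : X x -> x \in zspan.
Proof. by move=> Xx; apply/asboolP => S; apply. Qed.

Lemma zspan_ind (P : V -> Prop) :
  P 0 -> (forall u v, P u -> P v -> P (u - v)) -> (forall x, X x -> P x) ->
  forall v, v \in zspan -> P v.
Proof.
move=> P0 PB PX v /asboolP vX.
have Scl : zmod_closed ((fun u => `[< P u >]) : {pred V}).
  by split=> [|u w /asboolP Pu /asboolP Pw]; apply/asboolP; [|apply: PB].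
pose S : zmodClosed V := HB.pack ((fun u => `[< P u >]) : {pred V})
  (GRing.isZmodClosed.Build V _ Scl).
by apply/asboolP; apply: (vX S) => x Xx; apply/asboolP; apply: PX.
Qed.

End SubgroupSpan.

Section Tensor.
Variables (R : comPzRingType) (A : nuAlgType R).
Variables (M : rightModType A) (N : leftModType A).

Definition tensor_rel : set {freeg (M * N)%type} :=
  [set x | (exists m m' n, x = << (m + m', n) >> - << (m, n) >> - << (m', n) >>)
  \/ (exists m n n', x = << (m, n + n') >> - << (m, n) >> - << (m, n') >>)
  \/ (exists m a n, x = << (ract m a, n) >> - << (m, act a n) >>)
  \/ (exists m (r : R) n, x = << (r *: m, n) >> - << (m, r *: n) >>)].

Definition tensor : Type := Quotient.quot (zspan tensor_rel).
HB.instance Definition _ := GRing.Zmodule.on tensor.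

Definition tens (m : M) (n : N) : tensor :=
  \pi_(Quotient.quot (zspan tensor_rel)) << (m, n) >>.

Local Notation pi := (\pi_(Quotient.quot (zspan tensor_rel))).

Lemma tens_relE x y : x - y \in zspan tensor_rel -> pi x = pi y :> tensor.
Proof. by rewrite Quotient.idealrBE => /eqP. Qed.

Lemma tensDl m m' n : tens (m + m') n = tens m n + tens m' n.
Proof.
rewrite /tens -[RHS](raddfD pi); apply: tens_relE.
by rewrite opprD addrA; apply: zspan_gen; left; exists m, m', n.
Qed.

Lemma tensDr m n n' : tens m (n + n') = tens m n + tens m n'.
Proof.
rewrite /tens -[RHS](raddfD pi); apply: tens_relE.
by rewrite opprD addrA; apply: zspan_gen; right; left; exists m, n, n'.
Qed.

Lemma tensA m a n : tens (ract m a) n = tens m (act a n).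
Proof. by apply: tens_relE; apply: zspan_gen; do 2!right; left; exists m, a, n. Qed.

Lemma tensZ (r : R) m n : tens (r *: m) n = tens m (r *: n).
Proof. by apply: tens_relE; apply: zspan_gen; do 3!right; exists m, r, n. Qed.

Lemma tens_ind (P : tensor -> Prop) :
  P 0 -> (forall s t, P s -> P t -> P (s - t)) ->
  (forall m n, P (tens m n)) -> forall t, P t.
Proof.
move=> P0 PB Pt t.
have PN s : P s -> P (- s) by move=> Ps; rewrite -sub0r; apply: PB.
have PD s u : P s -> P u -> P (s + u).
  by move=> Ps Pu; rewrite -[u]opprK; apply/PB/PN.
rewrite -[t](@reprK _ (Quotient.quot (zspan tensor_rel))).
rewrite -[repr t]freeg_sumE raddf_sum.
elim/big_ind: _ => // -[m n] _.
have -> k : << k *g (m, n) >> = << (m, n) >> *~ k :> {freeg (M * N)%type}.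
  by rewrite freegU_mulz intz.
rewrite raddfMz.
have Pk k : P (tens m n *+ k).
  by elim: k => [|k IH]; rewrite ?mulr0n // mulrS; apply: PD.
case: (coeff _ _) => k; first by rewrite -pmulrn; apply: Pk.
by rewrite NegzE mulrNz -pmulrn; apply/PN/Pk.
Qed.

Section Lift.
Variables (V : zmodType) (F : M -> N -> V).

Record balanced : Prop := Balanced {
  balDl : forall m m' n, F (m + m') n = F m n + F m' n;
  balDr : forall m n n', F m (n + n') = F m n + F m n';
  balA : forall m (a : A) n, F (ract m a) n = F m (act a n);
  balZ : forall m (r : R) n, F (r *: m) n = F m (r *: n)
}.

Definition free_lift (x : {freeg (M * N)%type}) : V :=
  fglift (fun p => F p.1 p.2 : ssrint.zmodule V) x.

(* The additive map m (x) n |-> F m n; meaningful only for balanced F. *)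
Definition tens_lift (t : tensor) : V := free_lift (repr t).

Lemma free_liftB x y : free_lift (x - y) = free_lift x - free_lift y.
Proof. exact: (@lift_is_additive _ _ (ssrint.zmodule V)). Qed.

Lemma free_liftU p : free_lift << p >> = F p.1 p.2.
Proof. by rewrite /free_lift liftU scale1r. Qed.

Hypothesis balF : balanced.

Lemma free_lift_pi x : tens_lift (pi x) = free_lift x.
Proof.
apply/eqP; rewrite -subr_eq0 -free_liftB; apply/eqP.
have: repr (pi x) - x \in zspan tensor_rel.
  by rewrite Quotient.idealrBE reprK.
move: (_ - _); apply: zspan_ind; first by rewrite -(subrr 0) free_liftB subrr.
  by move=> u v Fu Fv; rewrite free_liftB Fu Fv subrr.
case: balF => Dl Dr FA FZ _ /= [[m [m' [n ->]]]|[[m [n [n' ->]]]|[[m [a [n ->]]]|[m [r [n ->]]]]]];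
  rewrite !free_liftB !free_liftU /= ?(Dl, Dr, FA, FZ) ?subrr //.
- by rewrite addrAC addrK subrr.
- by rewrite addrAC addrK subrr.
Qed.

Lemma tens_lift_tens m n : tens_lift (tens m n) = F m n.
Proof. by rewrite free_lift_pi free_liftU. Qed.

Lemma tens_lift_zmod : zmod_morphism tens_lift.
Proof.
move=> s t.
rewrite -[s](@reprK _ (Quotient.quot (zspan tensor_rel))).
rewrite -[t](@reprK _ (Quotient.quot (zspan tensor_rel))).
by rewrite -(raddfB pi) !free_lift_pi free_liftB.
Qed.

End Lift.

End Tensor.

Lemma tens_ext (R : comPzRingType) (A : nuAlgType R) (M : rightModType A)
    (N : leftModType A) (V : zmodType) (F G : tensor M N -> V) :
  zmod_morphism F -> zmod_morphism G ->
  (forall m n, F (tens m n) = G (tens m n)) -> F =1 G.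
Proof.
move=> FB GB FG; apply: tens_ind => // [|s t Fs Ft]; last by rewrite FB GB Fs Ft.
by rewrite -(subrr 0) FB GB !subrr.
Qed.

Section RegularModules.
Variables (R : comPzRingType) (A B : nuAlgType R).

Definition regmod : Type := B.
HB.instance Definition _ := GRing.Lmodule.on regmod.
HB.instance Definition _ := @Lmodule_isLeftMod.Build R B regmod
  (fun a b : B => (a * b)%g) (@numulDl R B) (@numulDr R B) (@mulgA B)
  (@nuscaleAl R B) (@nuscaleAr R B).

(* B as a right A-module; the alias is keyed on g so that it can carry the
   structure pulled back along g. *)
Definition via (g : {nualg A -> B}) : Type := B.

Variable g : {nualg A -> B}.
HB.instance Definition _ := GRing.Lmodule.on (via g).

Definition via_ract (b : via g) (a : A) : via g := ((b : B) * g a)%g.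

Fact via_ractDl m n a : via_ract (m + n) a = via_ract m a + via_ract n a.
Proof. exact: numulDl. Qed.
Fact via_ractDr m a b : via_ract m (a + b) = via_ract m a + via_ract m b.
Proof. by rewrite /via_ract raddfD; exact: numulDr. Qed.
Fact via_ractA m a b : via_ract (via_ract m a) b = via_ract m (a * b)%g.
Proof. by rewrite /via_ract gmulfM mulgA. Qed.
Fact via_ractZl (r : R) m a : r *: via_ract m a = via_ract (r *: m) a.
Proof. exact: nuscaleAl. Qed.
Fact via_ractZr (r : R) m a : r *: via_ract m a = via_ract m (r *: a).
Proof. by rewrite /via_ract linearZ; exact: nuscaleAr. Qed.

HB.instance Definition _ := @Lmodule_isRightMod.Build R A (via g)
  via_ract via_ractDl via_ractDr via_ractA via_ractZl via_ractZr.

End RegularModules.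

Section Extension.
Variables (R : comPzRingType) (A B : nuAlgType R) (g : {nualg A -> B}).
Variable M : leftModType A.

(* B (x)_A M as a left B-module. *)
Definition extension : Type := tensor (via g) M.
HB.instance Definition _ := GRing.Zmodule.on extension.

Definition etens (b : B) (m : M) : extension := tens (b : via g) m.

Lemma etensDl b b' m : etens (b + b') m = etens b m + etens b' m.
Proof. exact: tensDl. Qed.
Lemma etensDr b m m' : etens b (m + m') = etens b m + etens b m'.
Proof. exact: tensDr. Qed.
Lemma etensA b a m : etens (b * g a)%g m = etens b (act a m).
Proof. exact: (@tensA R A (via g) M b a m). Qed.
Lemma etensZ r b m : etens (r *: b) m = etens b (r *: m).
Proof. exact: (@tensZ R A (via g) M r b m). Qed.

Lemma etens_ext (V : zmodType) (F G : extension -> V) :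
  zmod_morphism F -> zmod_morphism G ->
  (forall b m, F (etens b m) = G (etens b m)) -> F =1 G.
Proof. exact: tens_ext. Qed.

Fact balanced_scale (r : R) :
  @balanced R A (via g) M extension (fun b m => etens (r *: (b : B)) m).
Proof.
split=> [b b' m|b m m'|b a m|b s m].
- by rewrite scalerDr etensDl.
- exact: etensDr.
- by rewrite /= -etensA -nuscaleAl.
- by rewrite -etensZ !scalerA mulrC.
Qed.

Fact balanced_act (c : B) :
  @balanced R A (via g) M extension (fun b m => etens (c * b)%g m).
Proof.
split=> [b b' m|b m m'|b a m|b s m].
- by rewrite [(c * _)%g]numulDr etensDl.
- exact: etensDr.
- by rewrite -etensA; congr (etens _ _); rewrite -mulgA.
- by rewrite -etensZ -nuscaleAr.
Qed.

Definition ext_scale (r : R) : extension -> extension :=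
  tens_lift (fun (b : via g) (m : M) => etens (r *: (b : B)) m).
Definition ext_act (c : B) : extension -> extension :=
  tens_lift (fun (b : via g) (m : M) => etens (c * (b : B))%g m).

Lemma ext_scale_etens r b m : ext_scale r (etens b m) = etens (r *: b) m.
Proof. exact: (tens_lift_tens (balanced_scale r)). Qed.
Lemma ext_act_etens c b m : ext_act c (etens b m) = etens (c * b)%g m.
Proof. exact: (tens_lift_tens (balanced_act c)). Qed.
Lemma ext_scaleB r : zmod_morphism (ext_scale r).
Proof. exact: (tens_lift_zmod (balanced_scale r)). Qed.
Lemma ext_actB c : zmod_morphism (ext_act c).
Proof. exact: (tens_lift_zmod (balanced_act c)). Qed.

Lemma zmod_morphismD (U V : zmodType) (F : U -> V) :
  zmod_morphism F -> {morph F : x y / x + y}.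
Proof.
move=> FB x y; have F0 : F 0 = 0 by rewrite -(subrr 0) FB subrr.
by rewrite -{1}[y]opprK FB -[- y]sub0r FB F0 sub0r opprK.
Qed.

Fact zmod_morphism_add (V : zmodType) (F G : extension -> V) :
  zmod_morphism F -> zmod_morphism G -> zmod_morphism (fun x => F x + G x).
Proof. by move=> FB GB x y; rewrite FB GB opprD addrACA. Qed.

Fact zmod_morphism_comp (F G : extension -> extension) :
  zmod_morphism F -> zmod_morphism G -> zmod_morphism (F \o G).
Proof. by move=> FB GB x y; rewrite /= GB FB. Qed.

Fact ext_scaleA r s x : ext_scale r (ext_scale s x) = ext_scale (r * s) x.
Proof.
move: x; apply: etens_ext => [||b m]; last by rewrite !ext_scale_etens scalerA.
  exact: zmod_morphism_comp (ext_scaleB r) (ext_scaleB s).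
exact: ext_scaleB.
Qed.
Fact ext_scale1 : left_id 1 ext_scale.
Proof.
apply: etens_ext => [||b m] //; first exact: ext_scaleB.
by rewrite ext_scale_etens scale1r.
Qed.
Fact ext_scaleDr : right_distributive ext_scale +%R.
Proof. by move=> r; apply: zmod_morphismD; apply: ext_scaleB. Qed.
Fact ext_scaleDl x : {morph ext_scale^~ x : r s / r + s}.
Proof.
move=> r s; move: x; apply: etens_ext => [||b m]; first exact: ext_scaleB.
  by apply: zmod_morphism_add; apply: ext_scaleB.
by rewrite !ext_scale_etens scalerDl etensDl.
Qed.

HB.instance Definition _ := @GRing.Zmodule_isLmodule.Build R extension
  ext_scale ext_scaleA ext_scale1 ext_scaleDr ext_scaleDl.

Fact ext_actDl c d x : ext_act (c + d) x = ext_act c x + ext_act d x.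
Proof.
move: x; apply: etens_ext => [||b m]; first exact: ext_actB.
  by apply: zmod_morphism_add; apply: ext_actB.
by rewrite !ext_act_etens numulDl etensDl.
Qed.
Fact ext_actDr c x y : ext_act c (x + y) = ext_act c x + ext_act c y.
Proof. exact/zmod_morphismD/ext_actB. Qed.
Fact ext_actA c d x : ext_act c (ext_act d x) = ext_act (c * d)%g x.
Proof.
move: x; apply: etens_ext => [||b m]; last by rewrite !ext_act_etens mulgA.
  exact: zmod_morphism_comp (ext_actB c) (ext_actB d).
exact: ext_actB.
Qed.
Fact ext_actZl r c x : r *: ext_act c x = ext_act (r *: c) x.
Proof.
move: x; apply: etens_ext => [||b m].
- exact: zmod_morphism_comp (ext_scaleB r) (ext_actB c).
- exact: ext_actB.
by rewrite !ext_act_etens [LHS]ext_scale_etens nuscaleAl.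
Qed.
Fact ext_actZr r c x : r *: ext_act c x = ext_act c (r *: x).
Proof.
move: x; apply: etens_ext => [||b m].
- exact: zmod_morphism_comp (ext_scaleB r) (ext_actB c).
- exact: zmod_morphism_comp (ext_actB c) (ext_scaleB r).
rewrite ext_act_etens [in RHS]/GRing.scale /= !ext_scale_etens ext_act_etens.
by rewrite [LHS]ext_scale_etens nuscaleAr.
Qed.

HB.instance Definition _ := @Lmodule_isLeftMod.Build R B extension
  ext_act ext_actDl ext_actDr ext_actA ext_actZl ext_actZr.

Lemma scale_etens r b m : r *: etens b m = etens (r *: b) m.
Proof. exact: ext_scale_etens. Qed.
Lemma act_etens (c b : B) m : act c (etens b m) = etens (c * b)%g m.
Proof. exact: ext_act_etens. Qed.

End Extension.

Section Homs.
Variables (R : comPzRingType) (A : nuAlgType R).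

HB.instance Definition _ (M : leftModType A) :=
  isEquivariant.Build R A M M idfun (fun _ _ => erefl).

Fact comp_equivariant (M N P : leftModType A) (f : {lmodhom N -> P})
    (h : {lmodhom M -> N}) a m : (f \o h) (act a m) = act a ((f \o h) m).
Proof. by rewrite /= !equivariant_act. Qed.
HB.instance Definition _ (M N P : leftModType A) (f : {lmodhom N -> P})
    (h : {lmodhom M -> N}) :=
  isEquivariant.Build R A M P (f \o h) (comp_equivariant f h).

Lemma lmodhom_eq (M N : leftModType A) (f h : {lmodhom M -> N}) :
  f =1 h -> f = h.
Proof.
case: f h => [f [[f1] [f2] [f3]]] [h [[h1] [h2] [h3]]] /= fh.
have {fh} E : f = h by apply: funext.
case: _ / E in h1 h2 h3 *.
by rewrite (Prop_irrelevance h1 f1) (Prop_irrelevance h2 f2)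
  (Prop_irrelevance h3 f3).
Qed.

HB.instance Definition _ := Multiplicative.on (@idfun A).

Variable M : leftModType A.

(* A (x)_A M, the right A-module A being the pullback of A along the identity. *)
Definition self_tensor : leftModType A := extension (idfun : {nualg A -> A}) M.

Definition act_map : self_tensor -> M :=
  tens_lift (fun (a : via (idfun : {nualg A -> A})) (m : M) => act (a : A) m).

Fact balanced_act_map :
  @balanced R A (via (idfun : {nualg A -> A})) M M (fun a m => act (a : A) m).
Proof.
split=> [a b m|a m n|a b m|a r m]; [exact: actDl|exact: actDr| |].
  by rewrite actA.
by rewrite -actZl -actZr.
Qed.

Lemma act_map_etens (a : A) (m : M) :
  act_map (etens (idfun : {nualg A -> A}) a m) = act a m.
Proof. exact: (tens_lift_tens balanced_act_map). Qed.

Fact act_map_zmod : zmod_morphism act_map.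
Proof. exact: (tens_lift_zmod balanced_act_map). Qed.
HB.instance Definition _ :=
  GRing.isZmodMorphism.Build self_tensor M act_map act_map_zmod.

Fact act_map_scale : scalable act_map.
Proof.
move=> r; apply: etens_ext => [x y|x y|b m].
- by rewrite scalerBr raddfB.
- by rewrite raddfB scalerBr.
by rewrite scale_etens !act_map_etens actZl.
Qed.
HB.instance Definition _ :=
  GRing.isScalable.Build R self_tensor M *:%R act_map act_map_scale.

Fact act_map_equivariant (a : A) (x : self_tensor) :
  act_map (act a x) = act a (act_map x).
Proof.
move: x; apply: etens_ext => [x y|x y|b m].
- by rewrite -raddfB; congr act_map; exact: ext_actB.
- rewrite raddfB; apply: (canRL (addrK _)); by rewrite -actDr subrK.
by rewrite act_etens !act_map_etens actA.
Qed.
HB.instance Definition _ :=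
  isEquivariant.Build R A self_tensor M act_map act_map_equivariant.

End Homs.

Record category := Category {
  obj :> Type;
  chom : obj -> obj -> Type;
  idc : forall X, chom X X;
  compc : forall X Y Z, chom Y Z -> chom X Y -> chom X Z;
  compc1 : forall X Y (f : chom X Y), compc f (idc X) = f;
  comp1c : forall X Y (f : chom X Y), compc (idc Y) f = f;
  compcA : forall X Y Z W (f : chom Z W) (g : chom Y Z) (h : chom X Y),
    compc f (compc g h) = compc (compc f g) h
}.
Arguments idc {c} X.

Definition is_iso (C : category) (X Y : C) (f : chom X Y) : Prop :=
  exists h : chom Y X, compc h f = idc X /\ compc f h = idc Y.

Definition full_subcategory (C : category) (P : C -> Prop) : category :=
  @Category {X : C | P X} (fun X Y => chom (sval X) (sval Y))
    (fun X => idc (sval X)) (fun X Y Z => @compc C (sval X) (sval Y) (sval Z))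
    (fun X Y => @compc1 C (sval X) (sval Y))
    (fun X Y => @comp1c C (sval X) (sval Y))
    (fun X Y Z W => @compcA C (sval X) (sval Y) (sval Z) (sval W)).

Record functor (C D : category) := Functor {
  fobj :> C -> D;
  fmap : forall X Y : C, chom X Y -> chom (fobj X) (fobj Y);
  fmap1 : forall X, fmap (idc X) = idc (fobj X);
  fmapM : forall X Y Z (f : chom Y Z) (h : chom X Y),
    fmap (compc f h) = compc (fmap f) (fmap h)
}.

(* Morphisms between equal objects, transported along the equalities. *)
Definition hom_cast (C : category) (X X' Y Y' : C) (eX : X = X') (eY : Y = Y')
    (f : chom X Y) : chom X' Y' :=
  ecast Z (chom X' Z) eY (ecast Z (chom Z Y) eX f).

Section ModuleCategories.
Variables (R : comPzRingType) (A : nuAlgType R).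

Definition lmod_cat : category :=
  @Category (leftModType A) (fun M N => {lmodhom M -> N})
    (fun M => idfun : {lmodhom M -> M})
    (fun M N P (f : {lmodhom N -> P}) (h : {lmodhom M -> N}) =>
       (f \o h : {lmodhom M -> P}))
    (fun M N f => @lmodhom_eq _ _ M N (f \o idfun) f (fun=> erefl))
    (fun M N f => @lmodhom_eq _ _ M N (idfun \o f) f (fun=> erefl))
    (fun M N P Q f g h => @lmodhom_eq _ _ M Q (f \o (g \o h)) ((f \o g) \o h)
       (fun=> erefl)).

Definition firm (M : leftModType A) : Prop :=
  @is_iso lmod_cat (self_tensor M) M (@act_map R A M : {lmodhom _ -> _}).

Definition firm_cat : category := @full_subcategory lmod_cat firm.

End ModuleCategories.

(* Main.v *)
(** Firmness of B means that multiplication B (x)_B B -> B has an inverse h.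
    Sending b (x) m to the image of h(b) under b1 (x) b2 |-> b1 (x) (b2 (x) m)
    inverts the action map of B (x)_A M. This is A-balanced in (b, m) because
    h(b c) = h(b) c, which is checked on products b = b1 b2: by firmness these
    generate B additively. *)
Require Import Defs.
From mathcomp Require Import all_boot all_algebra.
From HB Require Import structures.

Set Implicit Arguments.
Unset Strict Implicit.
Unset Printing Implicit Defensive.

Import GRing.Theory.
Local Open Scope ring_scope.

Lemma etens_zmodr (R : comPzRingType) (A B : nuAlgType R)
    (g : {nualg A -> B}) (M : leftModType A) (b : B) :
  zmod_morphism (@etens R A B g M b).
Proof. by move=> m n; apply: (canRL (addrK _)); rewrite -etensDr subrK. Qed.

Lemma act_zmodr (R : comPzRingType) (A : nuAlgType R) (M : leftModType A)
    (a : A) : zmod_morphism (@act R A M a).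
Proof. by move=> m n; apply: (canRL (addrK _)); rewrite -actDr subrK. Qed.

Section ExtensionMap.
Variables (R : comPzRingType) (A B : nuAlgType R) (g : {nualg A -> B}).
Variables (M N : leftModType A) (f : {lmodhom M -> N}).

(** The map usually written [id (x) f]. [tens_lift] evaluates on a chosen representative, so the
    formula acquires its meaning from [balanced_ext_map]. *)
Definition ext_map : extension g M -> extension g N :=
  tens_lift (fun (b : via g) (m : M) => etens g b (f m)).

Fact balanced_ext_map :
  @balanced R A (via g) M (extension g N) (fun b m => etens g b (f m)).
Proof.
split=> [b b' m|b m m'|b a m|b r m]; first exact: etensDl.
- by rewrite raddfD etensDr.
- by rewrite equivariant_act -etensA.
- by rewrite linearZ -etensZ.
Qed.

Lemma ext_map_etens b m : ext_map (etens g b m) = etens g b (f m).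
Proof. exact: (tens_lift_tens balanced_ext_map). Qed.

Fact ext_map_zmod : zmod_morphism ext_map.
Proof. exact: (tens_lift_zmod balanced_ext_map). Qed.
HB.instance Definition _ := GRing.isZmodMorphism.Build
  (extension g M) (extension g N) ext_map ext_map_zmod.

Fact ext_map_scale : scalable ext_map.
Proof.
move=> r; apply: etens_ext => [x y|x y|b m].
- by rewrite scalerBr raddfB.
- by rewrite raddfB scalerBr.
by rewrite scale_etens !ext_map_etens scale_etens.
Qed.
HB.instance Definition _ := GRing.isScalable.Build R
  (extension g M) (extension g N) *:%R ext_map ext_map_scale.

Fact ext_map_equivariant (b : B) (x : extension g M) :
  ext_map (act b x) = act b (ext_map x).
Proof.
move: x; apply: etens_ext => [x y|x y|c m].
- by rewrite act_zmodr raddfB.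
- by rewrite raddfB act_zmodr.
by rewrite act_etens !ext_map_etens act_etens.
Qed.
HB.instance Definition _ := isEquivariant.Build R B
  (extension g M) (extension g N) ext_map ext_map_equivariant.

End ExtensionMap.
Arguments ext_map {R A B} g {M N} f x.

Section EtensLeft.
Variables (R : comPzRingType) (A B : nuAlgType R) (g : {nualg A -> B}).
Variables (M : leftModType A) (m : M).

(** Typed on [regmod B] so that it becomes a morphism of left B-modules, to which [ext_map] along
    the identity of B applies. *)
Definition etensl (b : regmod B) : extension g M := etens g b m.

Fact etensl_zmod : zmod_morphism etensl.
Proof.
by move=> b c; apply: (canRL (addrK _)); rewrite /etensl -etensDl subrK.
Qed.
HB.instance Definition _ := GRing.isZmodMorphism.Build
  (regmod B) (extension g M) etensl etensl_zmod.

Fact etensl_scale : scalable etensl.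
Proof. by move=> r b; rewrite /etensl scale_etens. Qed.
HB.instance Definition _ := GRing.isScalable.Build R
  (regmod B) (extension g M) *:%R etensl etensl_scale.

Fact etensl_equivariant (b : B) (c : regmod B) :
  etensl (act b c) = act b (etensl c).
Proof. by rewrite /etensl act_etens. Qed.
HB.instance Definition _ := isEquivariant.Build R B
  (regmod B) (extension g M) etensl etensl_equivariant.

End EtensLeft.

(** A set-theoretic inverse inherits additivity, R-linearity and equivariance by cancellation, so
    firmness reduces to exhibiting an inverse function. *)
Lemma lmodhom_bij_iso (R : comPzRingType) (A : nuAlgType R)
    (M N : leftModType A) (f : {lmodhom M -> N}) (h : N -> M) :
  cancel f h -> cancel h f -> @is_iso (lmod_cat A) M N f.
Proof.
move=> fK hK.
have hB : zmod_morphism h := can2_zmod_morphism fK hK.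
have hZ : scalable h by move=> r x; rewrite -{1}[x]hK -linearZ fK.
have hE a x : h (act a x) = act a (h x).
  by rewrite -{1}[x]hK -equivariant_act fK.
pose h' : {lmodhom N -> M} := HB.pack h (GRing.isZmodMorphism.Build N M h hB)
  (GRing.isScalable.Build R N M *:%R h hZ) (isEquivariant.Build R A N M h hE).
by exists h'; split; apply: lmodhom_eq.
Qed.

Lemma ract_zmodl (R : comPzRingType) (A : nuAlgType R) (M : rightModType A)
    (a : A) : zmod_morphism (fun m : M => ract m a).
Proof. by move=> m n; apply: (canRL (addrK _)); rewrite -ractDl subrK. Qed.

Lemma firm_extension (R : comPzRingType) (A B : nuAlgType R)
    (g : {nualg A -> B}) (hB : firm (regmod B)) (M : leftModType A) :
  firm (extension g M : leftModType B).
Proof.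
have [h hK Kh] : exists2 h : {lmodhom regmod B -> self_tensor (regmod B)},
    cancel (@act_map R B (regmod B)) h & cancel h (@act_map R B (regmod B)).
  have [h [hK Kh]] := hB; exists h => x.
    (* The inverse laws are equalities of bundled morphisms; evaluating at [x] makes them
       pointwise. *)
    pose ev (k : {lmodhom self_tensor (regmod B) -> self_tensor (regmod B)}) :=
      k x.
    exact: (congr1 ev hK).
  by pose ev (k : {lmodhom regmod B -> regmod B}) := k x; exact: (congr1 ev Kh).
(* [psi m] sends b1 (x) b2 to b1 (x) (b2 (x) m). *)
pose psi m := ext_map (idfun : {nualg B -> B}) (@etensl R A B g M m).
have psiE m b c : psi m (h (b * c)%g) = etens idfun b (etens g c m).
  (* The product [b * c] is the image of b (x) c under the action map, so [h] returns b (x) c. *)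
  by rewrite -[(b * c)%g](@act_map_etens R B (regmod B)) hK [LHS]ext_map_etens.
(* Every [b] is the image of [h b], which is an integer combination of pure tensors; hence additive
   maps on B that agree on products are equal. *)
have act_mapP (V : zmodType) (F G : regmod B -> V) :
    zmod_morphism F -> zmod_morphism G ->
    (forall b c : B, F (b * c)%g = G (b * c)%g) -> F =1 G.
  move=> FB GB FG b; rewrite -[b]Kh; move: (h b).
  apply: etens_ext => [x y|x y|c d]; rewrite ?act_map_zmod ?FB ?GB //.
  by rewrite act_map_etens; exact: FG.
have psiB m b c : psi m (h (b - c)) = psi m (h b) - psi m (h c).
  by rewrite raddfB /psi raddfB.
have bal : @balanced R A (via g) M (self_tensor (extension g M))
    (fun b m => psi m (h b)).
  split=> [b b' m|b m n|b a m|b r m].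
  - by rewrite raddfD /psi raddfD.
  (* On products, [psiE] shows the dependence on [m] explicitly; additivity in [b] extends the
     identity to all of B. *)
  - move: b; apply: act_mapP => [b c|b c|b c]; first exact: psiB.
      by rewrite !psiB opprD addrACA.
    by rewrite !psiE !etensDr.
  - move: b; apply: act_mapP => [b c|b c|b c].
    + by rewrite (@ract_zmodl R A (via g) a b c) psiB.
    + exact: psiB.
    (* Here (b c) g(a) = b (c g(a)), and the factor g(a) crosses the inner tensor to act on [m]. *)
    by rewrite psiE -etensA -psiE mulgA.
  - move: b; apply: act_mapP => [b c|b c|b c].
    + by rewrite scalerBr psiB.
    + exact: psiB.
    by rewrite psiE -etensZ -psiE nuscaleAr.
pose inv : extension g M -> self_tensor (extension g M) :=
  tens_lift (fun (b : via g) m => psi m (h b)).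
have invE b m : inv (etens g b m) = psi m (h b) := tens_lift_tens bal b m.
have invB : zmod_morphism inv := tens_lift_zmod bal.
suff [invK Kinv] : cancel (@act_map R B (extension g M)) inv
    /\ cancel inv (@act_map R B (extension g M)).
  exact: lmodhom_bij_iso invK Kinv.
split.
(* Two nested extensionality arguments reduce to b (x) (c (x) m), which the action map sends to (b
   c) (x) m and [psiE] brings back. *)
- apply: etens_ext => // [x y|b x]; first by rewrite raddfB invB.
  rewrite act_map_etens; move: x; apply: etens_ext => [x y|x y|c m].
  + by rewrite act_zmodr invB.
  + by rewrite etens_zmodr.
  by rewrite act_etens invE psiE.
- apply: etens_ext => // [x y|b m]; first by rewrite invB raddfB.
  (* Only for [b] a product is [h b] known explicitly, hence the second reduction by [act_mapP]. *)
  rewrite invE; move: b; apply: act_mapP => [b c|b c|b c].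
  + by rewrite psiB raddfB.
  + exact: (@etensl_zmod R A B g M m).
  by rewrite psiE act_map_etens act_etens.
Qed.

Lemma ext_map_id (R : comPzRingType) (A B : nuAlgType R) (g : {nualg A -> B})
    (M : leftModType A) : ext_map g (idfun : {lmodhom M -> M}) =1 id.
Proof.
by apply: etens_ext => [x y|//|b m]; rewrite ?ext_map_zmod ?ext_map_etens.
Qed.

Lemma ext_map_comp (R : comPzRingType) (A B : nuAlgType R) (g : {nualg A -> B})
    (M N P : leftModType A) (f : {lmodhom N -> P}) (h : {lmodhom M -> N}) :
  ext_map g (f \o h : {lmodhom M -> P}) =1 ext_map g f \o ext_map g h.
Proof.
apply: etens_ext => [x y|x y|b m] /=; first exact: ext_map_zmod.
  by rewrite !raddfB.
by rewrite !ext_map_etens.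
Qed.

(** Transparent, so that its value on objects computes to [extension g M]. *)
Definition extension_functor (R : comPzRingType) (A B : nuAlgType R)
    (g : {nualg A -> B}) (hB : firm (regmod B)) :
  functor (lmod_cat A) (firm_cat B) :=
  @Functor (lmod_cat A) (firm_cat B)
    (fun M => exist (@firm R B) (extension g M) (@firm_extension R A B g hB M))
    (fun M N f => ext_map g f)
    (fun M => @lmodhom_eq R B (extension g M) (extension g M)
       (ext_map g (idfun : {lmodhom M -> M})) idfun (@ext_map_id R A B g M))
    (fun M N P f h => @lmodhom_eq R B (extension g M) (extension g P)
       (ext_map g (f \o h : {lmodhom M -> P})) (ext_map g f \o ext_map g h)
       (@ext_map_comp R A B g M N P f h)).

Theorem theorem8 (R : comPzRingType) (A B : nuAlgType R) (g : {nualg A -> B})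
    (hB : firm (regmod B)) :
  exists (E : functor (lmod_cat A) (firm_cat B))
    (objE : forall M : leftModType A,
       sval (E M) = (extension g M : leftModType B) :> lmod_cat B),
    forall (M N : leftModType A) (f : {lmodhom M -> N}) (b : B) (m : M),
      (hom_cast (objE M) (objE N) (fmap E f)
        : {lmodhom extension g M -> extension g N}) (etens g b m)
      = etens g b (f m).
Proof.
(* The object equalities hold by computation; with [erefl] the transport [hom_cast] reduces away. *)
exists (extension_functor g hB), (fun=> erefl) => M N f b m.
exact: ext_map_etens.
Qed.
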